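(* When $H_i>0$ for all $i\in\{0,\dots,N\}$ and $E[Q_i]>0$ for some $i$, the minimizer of $$\tilde{\mathcal F}(w)=\sum_{i=0}^N\frac{E[Q_i]}{w_iH_i}$$ subject to $\sum_{i=0}^N w_i=1$ and $w_i>0$ for all $i$ is $$w_i^*=\frac1D\sqrt{\frac{E[Q_i]}{H_i}}\quad\text{for all } i=0,\dots,N,\qquad\text{where } D=\sum_{j=0}^N\sqrt{\frac{E[Q_j]}{H_j}}.$$
   Context: For a pool of currencies $0,\dots,N$, $E[Q_i]$ is the expected total trading volume (a non-negative number) involving currency $i$, and $H_i=\sum_{j\neq i}\sigma_{ij}^2$, where $\sigma_{ij}^2$ is the variance of the difference of the gross returns of currencies $i$ and $j$. The function $\tilde{\mathcal F}$ is a heuristic replacement for the objective $\left(\sum_{i<j}w_iw_j\sigma_{ij}^2\right)\sum_i E[Q_i]/w_i$ in choosing the weights $w_i$ of a constant-mean AMM pool.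
   Formalization: If some E[Q_i]=0 then w*_i=0 violates w_i>0 and no minimizer exists; the claim is proved when all E[Q_i]>0, and otherwise w* is the unique minimizer over w_i≥0 (0/0=0, a/0=+∞), with value the infimum over w_i>0. *)

(* Defs.v *)
From HB Require Import structures.
From mathcomp Require Import all_boot all_order all_algebra.
From mathcomp Require Import all_classical all_reals all_analysis.

Set Implicit Arguments.
Unset Strict Implicit.
Unset Printing Implicit Defensive.

Import Order.TTheory GRing.Theory Num.Theory.

Local Open Scope classical_set_scope.
Local Open Scope ring_scope.

Definition is_minimizer {T : Type} {disp : Order.disp_t} {V : porderType disp}
    (f : T -> V) (A : set T) (x : T) : Prop :=
  A x /\ forall y, A y -> (f x <= f y)%O.

(* The weights of a pool with currencies 0, .., N are row vectors of length
   N.+1. *)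
Definition open_simplex {R : realType} (N : nat) : set 'rV[R]_N.+1 :=
  [set w | \sum_i w 0 i = 1 /\ forall i, 0 < w 0 i].

Definition closed_simplex {R : realType} (N : nat) : set 'rV[R]_N.+1 :=
  [set w | \sum_i w 0 i = 1 /\ forall i, 0 <= w 0 i].

Arguments open_simplex {R} N.
Arguments closed_simplex {R} N.

Section Pool.
Context {d : measure_display} {T : measurableType d} {R : realType}.
Variables (P : probability T R) (N : nat).

(* [ret i] is the gross return of currency i. *)
Definition return_diff (ret : 'I_N.+1 -> {RV P >-> R}) (i j : 'I_N.+1)
  : T -> R := fun t => ret i t - ret j t.

Definition sigma2 (ret : 'I_N.+1 -> {RV P >-> R}) (i j : 'I_N.+1) : R :=
  fine 'V_P[return_diff ret i j].

Definition pool_H (ret : 'I_N.+1 -> {RV P >-> R}) (i : 'I_N.+1) : R :=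
  \sum_(j < N.+1 | j != i) sigma2 ret i j.

(* [Q i] is the total trading volume involving currency i. *)
Definition mean_volume (Q : 'I_N.+1 -> {RV P >-> R}) (i : 'I_N.+1) : R :=
  fine 'E_P[Q i].

End Pool.

Definition Ftilde {R : realType} (N : nat) (q h : 'I_N.+1 -> R)
    (w : 'rV[R]_N.+1) : R :=
  \sum_i q i / (w 0 i * h i).

(* Extended-real version, meaningful also when some weights vanish: in \bar R,
   a / 0 = +oo for a > 0 and 0 / 0 = 0 * +oo = 0 (whereas a / 0 = 0 in R). *)
Definition Ftilde_ext {R : realType} (N : nat) (q h : 'I_N.+1 -> R)
    (w : 'rV[R]_N.+1) : \bar R :=
  (\sum_i (q i)%:E / (w 0 i * h i)%:E)%E.

Lemma Ftilde_extE {R : realType} (N : nat) (q h : 'I_N.+1 -> R)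
    (w : 'rV[R]_N.+1) :
  (forall i, 0 < h i) -> open_simplex N w ->
  Ftilde_ext q h w = (Ftilde q h w)%:E.
Proof.
move=> h0 [_ w0]; rewrite /Ftilde_ext /Ftilde -sumEFin.
by apply: eq_bigr => i _; rewrite inver gt_eqF ?mulr_gt0// -EFinM.
Qed.

(* Main.v *)
(** With [s i = sqrt (q i / h i)] and [D = \sum_i s i], completing the square
    gives, for every [w] with [\sum_i w i = 1] whose zeros are zeros of [s],
    [\sum_i s i ^ 2 / w i = D ^ 2 + \sum_i (s i - D w i) ^ 2 / w i].
    Hence [D ^ 2] is a lower bound, attained only at [w i = s i / D]. When some
    [q i] vanish, this point is on the boundary of the simplex; moving it a
    little towards the barycentre shows that [D ^ 2] is still the infimum over
    the open simplex. *)

Require Import Defs.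
From HB Require Import structures.
From mathcomp Require Import all_boot all_order all_algebra.
From mathcomp Require Import all_classical all_reals all_analysis.
From mathcomp Require Import ring.

Set Implicit Arguments.
Unset Strict Implicit.
Unset Printing Implicit Defensive.

Import Order.TTheory GRing.Theory Num.Theory.

Local Open Scope classical_set_scope.
Local Open Scope ring_scope.

Section WeightOptimization.
Context {R : realType} (N : nat) (q h : 'I_N.+1 -> R).
Hypotheses (q_ge0 : forall i, 0 <= q i) (h_gt0 : forall i, 0 < h i).

Let s i := Num.sqrt (q i / h i).
Let D := \sum_i s i.
Let wopt : 'rV[R]_N.+1 := \row_i (1 / D * s i).

Lemma sqrt_ratio_eq0 i : (s i == 0) = (q i == 0).
Proof.
have h0 := h_gt0 i.
rewrite sqrtr_eq0 le_eqVlt ltNge divr_ge0 ?(ltW h0)//= orbF.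
by rewrite mulf_eq0 invr_eq0 (gt_eqF h0) orbF.
Qed.

Lemma Ftilde_termE (w : R) i : q i / (w * h i) = s i ^+ 2 / w.
Proof.
by rewrite sqr_sqrtr ?divr_ge0 ?(ltW (h_gt0 i))// invfM mulrA mulrAC.
Qed.

(* [w 0 i = 0] is allowed when [q i = 0]: the term is then [0 / 0 = 0]. *)
Lemma Ftilde_complete_square (w : 'rV[R]_N.+1) :
  \sum_i w 0 i = 1 -> (forall i, w 0 i = 0 -> q i = 0) ->
  Ftilde q h w = D ^+ 2 + \sum_i (s i - D * w 0 i) ^+ 2 / w 0 i.
Proof.
move=> w1 wq.
(* Each square is expanded and divided by [w 0 i]. Since the [s i] sum to [D] and the weights to 1,
   the linear terms add up to [2 D ^ 2 - D ^ 2 = D ^ 2]. *)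
transitivity (\sum_i (D * s i *+ 2 - D ^+ 2 * w 0 i
                       + (s i - D * w 0 i) ^+ 2 / w 0 i)).
  apply: eq_bigr => i _; rewrite Ftilde_termE.
  have [w0|w0] := eqVneq (w 0 i) 0; last by field.
  have /eqP -> : s i == 0 by rewrite sqrt_ratio_eq0 wq.
  by rewrite w0; ring.
rewrite big_split/= sumrB sumrMnl -!mulr_sumr w1 -/D; congr (_ + _).
by ring.
Qed.

Lemma Ftilde_ge (w : 'rV[R]_N.+1) :
  closed_simplex N w -> (forall i, w 0 i = 0 -> q i = 0) ->
  D ^+ 2 <= Ftilde q h w.
Proof.
move=> [w1 w0] wq; rewrite Ftilde_complete_square// lerDl sumr_ge0// => i _.
by rewrite divr_ge0 ?sqr_ge0.
Qed.

(** The two division conventions differ only on [a / 0] with [a] nonzero; both give [0 / 0 = 0]. *)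
Lemma Ftilde_ext_fin (w : 'rV[R]_N.+1) : (forall i, w 0 i = 0 -> q i = 0) ->
  Ftilde_ext q h w = (Ftilde q h w)%:E.
Proof.
move=> wq; rewrite /Ftilde_ext /Ftilde -sumEFin; apply: eq_bigr => i _.
have [w0|w0] := eqVneq (w 0 i) 0; first by rewrite wq// !mul0r mul0e.
by rewrite inver mulf_eq0 (negbTE w0) gt_eqF.
Qed.

Lemma Ftilde_ext_pinfty (w : 'rV[R]_N.+1) i : (forall j, 0 <= w 0 j) ->
  w 0 i = 0 -> 0 < q i -> Ftilde_ext q h w = +oo%E.
Proof.
move=> w0 wi qi; rewrite /Ftilde_ext (bigD1 i)//= wi mul0r.
rewrite inver eqxx gt0_muley ?lte_fin// addye//.
(* The other terms have a nonnegative sum, which is therefore not [-oo] and cannot cancel the [+oo]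
   of term [i]. *)
rewrite gt_eqF// (lt_le_trans (ltNyr 0))// sume_ge0// => j _.
by rewrite mule_ge0 ?lee_fin// inve_ge0 lee_fin mulr_ge0 ?(ltW (h_gt0 j)).
Qed.

Lemma Ftilde_ext_ge (w : 'rV[R]_N.+1) :
  closed_simplex N w -> ((D ^+ 2)%:E <= Ftilde_ext q h w)%E.
Proof.
move=> w_cs; have [w1 w0] := w_cs.
have [[i [wi qi]]|wq] := pselect (exists i, w 0 i = 0 /\ q i <> 0).
  rewrite (Ftilde_ext_pinfty w0 wi) ?leey//.
  by rewrite lt_neqAle q_ge0 andbT eq_sym; apply/eqP.
have {}wq i : w 0 i = 0 -> q i = 0.
  by move=> wi; apply: contrapT => qi; apply: wq; exists i.
by rewrite Ftilde_ext_fin// lee_fin Ftilde_ge.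
Qed.

Hypothesis q_gt0 : exists i, 0 < q i.

Lemma sqrt_ratio_sum_gt0 : 0 < D.
Proof.
have [i qi] := q_gt0; rewrite /D (bigD1 i)//= ltr_pwDl//.
  by rewrite sqrtr_gt0 divr_gt0.
by apply: sumr_ge0 => j _; exact: sqrtr_ge0.
Qed.
Let D_gt0 := sqrt_ratio_sum_gt0.

(** This is the proviso on zero weights, so the completed square applies at [wopt] even on the
    boundary. *)
Lemma wopt_eq0 i : wopt 0 i = 0 -> q i = 0.
Proof.
rewrite mxE div1r => /eqP; rewrite mulf_eq0 invr_eq0 gt_eqF//=.
by rewrite sqrt_ratio_eq0 => /eqP.
Qed.

Lemma wopt_closed_simplex : closed_simplex N wopt.
Proof.
split=> [|i]; last by rewrite mxE div1r mulr_ge0 ?sqrtr_ge0// invr_ge0 ltW.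
under eq_bigr do rewrite mxE.
by rewrite -mulr_sumr -/D div1r mulVf// gt_eqF.
Qed.

Lemma wopt_open_simplex : (forall i, 0 < q i) -> open_simplex N wopt.
Proof.
move=> qp; split=> [|i]; first by case: wopt_closed_simplex.
by rewrite mxE div1r mulr_gt0 ?invr_gt0// sqrtr_gt0 divr_gt0.
Qed.

Lemma Ftilde_wopt : Ftilde q h wopt = D ^+ 2.
Proof.
have [wopt1 _] := wopt_closed_simplex.
rewrite (Ftilde_complete_square wopt1 wopt_eq0) big1 ?addr0// => i _.
by rewrite mxE div1r mulVKf ?gt_eqF// subrr expr0n mul0r.
Qed.

Lemma Ftilde_ext_wopt : Ftilde_ext q h wopt = (D ^+ 2)%:E.
Proof. by rewrite Ftilde_ext_fin ?Ftilde_wopt//; exact: wopt_eq0. Qed.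

(** The excess over [D ^ 2] is a sum of nonnegative terms, so if it is at most 0, every term
    vanishes. *)
Lemma Ftilde_le_wopt (w : 'rV[R]_N.+1) :
  closed_simplex N w -> (forall i, w 0 i = 0 -> q i = 0) ->
  Ftilde q h w <= D ^+ 2 -> w = wopt.
Proof.
move=> [w1 w0] wq; rewrite Ftilde_complete_square// gerDl => sq_le0.
have sq_ge0 i : 0 <= (s i - D * w 0 i) ^+ 2 / w 0 i.
  by rewrite divr_ge0 ?sqr_ge0.
have /eqP : \sum_i (s i - D * w 0 i) ^+ 2 / w 0 i = 0.
  by apply/eqP; rewrite eq_le sq_le0 sumr_ge0.
rewrite psumr_eq0// => /allP sq0; apply/rowP => i; rewrite mxE.
suff -> : s i = D * w 0 i by rewrite div1r mulKf// gt_eqF.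
have := sq0 i (mem_index_enum _).
(* A term can also vanish through division by [w 0 i = 0]; then [q i = 0], and [s i] and [D * w 0 i]
   are both 0. *)
rewrite /= mulf_eq0 invr_eq0 sqrf_eq0 subr_eq0 => /orP[/eqP//|/eqP wi].
by apply/eqP; rewrite wi mulr0 sqrt_ratio_eq0 wq.
Qed.

(** A value bounded by [D ^ 2] is not [+oo], so weights vanish only where [q] does, and the
    real-valued case applies. *)
Lemma Ftilde_ext_le_wopt (w : 'rV[R]_N.+1) :
  closed_simplex N w -> (Ftilde_ext q h w <= (D ^+ 2)%:E)%E -> w = wopt.
Proof.
move=> w_cs Fle; have wq i : w 0 i = 0 -> q i = 0.
  move=> wi; apply/eqP; apply: contraTT Fle => qi.
  rewrite (Ftilde_ext_pinfty (proj2 w_cs) wi) ?leye_eq//.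
  by rewrite lt_neqAle eq_sym qi q_ge0.
by apply: Ftilde_le_wopt => //; rewrite -lee_fin -Ftilde_ext_fin.
Qed.

Lemma Ftilde_minimizerP (w : 'rV[R]_N.+1) : (forall i, 0 < q i) ->
  is_minimizer (Ftilde q h) (open_simplex N) w <-> w = wopt.
Proof.
move=> qp.
have open_closed v : open_simplex N v -> closed_simplex N v.
  by move=> [v1 v0]; split=> // i; exact: ltW.
have open_neq0 v : open_simplex N v -> forall i, v 0 i = 0 -> q i = 0.
  by move=> [_ v0] i vi; have := v0 i; rewrite vi ltxx.
split=> [[w_os w_min]|->].
  apply: Ftilde_le_wopt; [exact: open_closed|exact: open_neq0|].
  by rewrite -Ftilde_wopt; apply: w_min; exact: wopt_open_simplex.
split=> [|v v_os]; first exact: wopt_open_simplex.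
by rewrite Ftilde_wopt; apply: Ftilde_ge; [exact: open_closed|exact: open_neq0].
Qed.

Lemma Ftilde_ext_minimizerP (w : 'rV[R]_N.+1) :
  is_minimizer (Ftilde_ext q h) (closed_simplex N) w <-> w = wopt.
Proof.
split=> [[w_cs w_min]|->].
  apply: Ftilde_ext_le_wopt => //; rewrite -Ftilde_ext_wopt.
  exact: w_min wopt_closed_simplex.
split=> [|v v_cs]; first exact: wopt_closed_simplex.
by rewrite Ftilde_ext_wopt; exact: Ftilde_ext_ge.
Qed.

(** The witness is [t * wopt] plus [1 - t] times the barycentre. Its weights are at least
    [t * wopt 0 i], so its value is at most [D ^ 2 / t]. *)
Lemma Ftilde_near_opt (e : R) : 0 < e ->
  exists2 w, open_simplex N w & Ftilde q h w <= D ^+ 2 + e.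
Proof.
move=> e0; have D0 := D_gt0.
have De0 : 0 < D ^+ 2 + e by rewrite addr_gt0 ?exprn_gt0.
(* With this [t], [D ^ 2 / t = D ^ 2 + e]. *)
pose t := D ^+ 2 / (D ^+ 2 + e).
have t0 : 0 < t by rewrite divr_gt0 ?exprn_gt0.
have t1 : t < 1 by rewrite ltr_pdivrMr// mul1r ltrDl.
pose u : R := (1 - t) / N.+1%:R.
have u0 : 0 < u by rewrite divr_gt0 ?subr_gt0.
have wE i : (\row_j (t * wopt 0 j + u) : 'rV[R]_N.+1) 0 i = t * wopt 0 i + u.
  by rewrite mxE.
have [wopt1 wopt0] := wopt_closed_simplex.
exists (\row_j (t * wopt 0 j + u)).
  split=> [|i]; last by rewrite wE ltr_wpDl// mulr_ge0// ltW.
  under eq_bigr do rewrite wE.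
  rewrite big_split/= -mulr_sumr wopt1 sumr_const card_ord -mulr_natr.
  by rewrite divfK ?pnatr_eq0// mulr1 subrKC.
have <- : D ^+ 2 / t = D ^+ 2 + e.
  by rewrite /t invf_div mulrCA divff ?mulr1// expf_neq0// gt_eqF.
rewrite -Ftilde_wopt mulr_suml; apply: ler_sum => i _.
rewrite wE !Ftilde_termE.
(* Where [s i = 0] both terms are 0; elsewhere [wopt 0 i] is positive, as comparing inverses
   requires. *)
have [->|si] := eqVneq (s i) 0; first by rewrite expr0n !mul0r.
have wi : 0 < wopt 0 i.
  rewrite lt_neqAle wopt0 andbT eq_sym mxE div1r mulf_neq0//.
  by rewrite invr_neq0// gt_eqF.
rewrite -[leRHS]mulrA -invfM ler_wpM2l ?sqr_ge0//.
have tw : 0 < t * wopt 0 i by exact: mulr_gt0.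
have twu : 0 < t * wopt 0 i + u by exact: addr_gt0.
by rewrite [wopt 0 i * t]mulrC lef_pV2 ?posrE// lerDl ltW.
Qed.

(** [Ftilde_near_opt] bounds the infimum above by [D ^ 2 + e] for every [e > 0]; the lower bound on
    the closed simplex restricts to the open one. *)
Lemma ereal_inf_Ftilde :
  ereal_inf [set (Ftilde q h w)%:E | w in open_simplex N]
  = Ftilde_ext q h wopt.
Proof.
rewrite Ftilde_ext_wopt; apply/eqP; rewrite eq_le; apply/andP; split.
  apply/lee_addgt0Pr => e e0; have [w w_os Fw] := Ftilde_near_opt e0.
  rewrite -EFinD; apply: le_trans (_ : (Ftilde q h w)%:E <= _)%E.
    by apply: ereal_inf_lbound; exists w.
  by rewrite lee_fin.
apply/ereal_infP => _ [w w_os <-]; rewrite -(Ftilde_extE _ h_gt0 w_os)//.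
by apply: Ftilde_ext_ge; case: w_os => w1 w0; split=> // i; exact: ltW.
Qed.

End WeightOptimization.

Theorem proposition8 (d : measure_display) (T : measurableType d)
    (R : realType) (P : probability T R) (N : nat)
    (ret Q : 'I_N.+1 -> {RV P >-> R})
    (ret_L2 : forall i j : 'I_N.+1, j != i ->
       return_diff ret i j \in Lfun P 2%:E)
    (Q_L1 : forall i : 'I_N.+1, (Q i : T -> R) \in Lfun P 1%:E)
    (EQ_ge0 : forall i : 'I_N.+1, 0 <= mean_volume Q i)
    (H_gt0 : forall i : 'I_N.+1, 0 < pool_H ret i)
    (EQ_gt0 : exists i : 'I_N.+1, 0 < mean_volume Q i) :
  let EQ := mean_volume Q in
  let H := pool_H ret in
  let D := \sum_(j < N.+1) Num.sqrt (EQ j / H j) in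
  let wstar := \row_(i < N.+1) (1 / D * Num.sqrt (EQ i / H i)) in
  [/\ (forall i : 'I_N.+1, 0 < EQ i) ->
        forall w : 'rV[R]_N.+1,
          is_minimizer (Ftilde EQ H) (open_simplex N) w <-> w = wstar,
      forall w : 'rV[R]_N.+1,
        is_minimizer (Ftilde_ext EQ H) (closed_simplex N) w <-> w = wstar
    & ereal_inf [set (Ftilde EQ H w)%:E | w in open_simplex N]
        = Ftilde_ext EQ H wstar].
Proof.
move=> EQ H D wstar; split.
- by move=> EQ_pos w; exact: Ftilde_minimizerP.
- by move=> w; exact: Ftilde_ext_minimizerP.
- exact: ereal_inf_Ftilde.
Qed.
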